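(* As $n\to\infty$, $$\mathrm{pnw}(n)=O\left(\frac{2^n(\ln n)^2}{n}\right)=o(2^n).$$
   Context: A binary word is a finite sequence over $\{0,1\}$. A binary word $w$ is prefix normal if for every $1\le i\le |w|$, no (contiguous) substring of $w$ of length $i$ contains more $1$s than the prefix of $w$ of length $i$. $\mathrm{pnw}(n)$ denotes the number of prefix normal words of length $n$. $f(n)=O(g(n))$ means there are $C>0$ and $n_0$ with $f(n)\le C g(n)$ for all $n\ge n_0$; $f(n)=o(g(n))$ means $f(n)/g(n)\to 0$. *)

(* Defs.v *)
From mathcomp Require Import all_boot all_order all_algebra.
From mathcomp Require Import all_classical all_reals all_analysis.

Set Implicit Arguments.
Unset Strict Implicit.
Unset Printing Implicit Defensive.

Local Open Scope nat_scope.

(* Binary words are sequences of booleans, [true] standing for the letter 1. *)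
Definition ones (w : seq bool) : nat := count_mem true w.

(* [infix u w] : u is a contiguous substring of w. *)
Definition prefix_normal (w : seq bool) : Prop :=
  forall i : nat, 1 <= i <= size w ->
  forall u : seq bool, infix u w -> size u = i ->
  ones u <= ones (take i w).

Definition pnw (n : nat) : nat :=
  #|[pred w : n.-tuple bool | `[< prefix_normal w >] ]|.

(* Main.v *)
Require Import Defs.
From mathcomp Require Import all_boot all_order all_algebra.
From mathcomp Require Import ring lra.
From mathcomp Require Import all_classical all_reals all_analysis.

Set Implicit Arguments.
Unset Strict Implicit.
Unset Printing Implicit Defensive.

Import Order.TTheory GRing.Theory Num.Theory.
Import numFieldNormedType.Exports.
Local Open Scope classical_set_scope.
Local Open Scope ring_scope.

(* A prefix normal word containing the factor 1^l must start with 1^l.  So cut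
   the word into m = n / l blocks of length l: either the first block is 1^l
   (probability 2^-l), or no block is (probability (1 - 2^-l)^m, at most
   exp (- m / 2^l)).  Taking 2^l of order n / (ln n)^2 makes the first
   probability O((ln n)^2 / n) and the second at most 1 / n. *)

(** Cutting a word after [a] letters and gluing back is the identity, so concatenation maps the
    product set onto a set containing every word counted on the left. *)
Lemma card_tuple_split (a b : nat) (P Q : pred (seq bool)) :
  (#|[pred w : (a + b).-tuple bool | P (take a w) && Q (drop a w)]| <=
   #|[pred u : a.-tuple bool | P u]| * #|[pred v : b.-tuple bool | Q v]|)%N.
Proof.
rewrite -cardX.
pose cat2 (p : a.-tuple bool * b.-tuple bool) := cat_tuple p.1 p.2.
apply: leq_trans (leq_image_card cat2 _).
apply/subset_leq_card/fintype.subsetP => w; rewrite inE => /andP[Pw Qw].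
have su : size (take a w) == a by rewrite size_takel // size_tuple leq_addr.
have sv : size (drop a w) == b by rewrite size_drop size_tuple addKn.
apply/fintype.imageP; exists (Tuple su, Tuple sv); first by rewrite !inE /= Pw.
by apply/val_inj; rewrite /= cat_take_drop.
Qed.

(** Only [m] disjoint aligned blocks are tested, not all factors of length [l]: the conditions are
    then independent and the count is a product. *)
Fixpoint blocks_avoid (l m : nat) (w : seq bool) : bool :=
  if m is m'.+1 then
    (take l w != nseq l true) && blocks_avoid l m' (drop l w)
  else true.

Lemma card_blocks_avoid (l m r : nat) :
  (#|[pred w : (m * l + r).-tuple bool | blocks_avoid l m w]| <=
   (2 ^ l - 1) ^ m * 2 ^ r)%N.
Proof.
elim: m => [|m IHm].
  by rewrite mul1n (leq_trans (max_card _)) // card_tuple card_bool.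
rewrite mulSn -addnA.
apply: leq_trans
  (card_tuple_split l (m * l + r) (predC1 (nseq l true)) (blocks_avoid l m)) _.
rewrite expnS -mulnA leq_mul //.
rewrite (eq_card (B := predC1 (nseq_tuple l true))) //.
by rewrite cardC1 card_tuple card_bool subn1.
Qed.

Lemma card_ones_prefix (l r : nat) :
  (#|[pred w : (l + r).-tuple bool | take l w == nseq l true]| <= 2 ^ r)%N.
Proof.
have := card_tuple_split l r (pred1 (nseq l true)) predT.
rewrite (eq_card
  (B := [pred w : (l + r).-tuple bool | take l w == nseq l true])).
  move=> /leq_trans; apply.
  rewrite (eq_card (B := pred1 (nseq_tuple l true))) // card1 mul1n.
  by rewrite (leq_trans (max_card _)) // card_tuple card_bool.
by move=> w; rewrite !inE andbT.
Qed.

Lemma blocks_avoid_infix (l m : nat) (w : seq bool) :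
  ~~ infix (nseq l true) w -> blocks_avoid l m w.
Proof.
elim: m w => // m IHm w nw /=; apply/andP; split.
  apply: contra nw => /eqP <-; exact: infix_take.
apply: IHm; apply: contra nw => /infix_trans; apply; exact: infix_drop.
Qed.

Lemma prefix_normal_blocks (l m : nat) (w : seq bool) :
  (0 < l <= size w)%N -> prefix_normal w ->
  (take l w == nseq l true) || blocks_avoid l m w.
Proof.
move=> lw pw.
case: (boolP (infix (nseq l true) w)) => [inf|/blocks_avoid_infix->].
  (* The factor 1^l has [l] ones, so the prefix of length [l] has at least [l] ones and consists of
     ones only. *)
  have := pw l lw _ inf (size_nseq _ _).
  rewrite /ones count_nseq /= mul1n => le_l.
  have sl : size (take l w) = l by rewrite size_takel //; case/andP: lw.
  have : all (pred1 true) (take l w).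
    by rewrite all_count eqn_leq count_size sl.
  by move/all_pred1P; rewrite sl => ->; rewrite eqxx.
by rewrite orbT.
Qed.

Lemma pnw_le (n l m : nat) : (0 < l)%N -> (0 < m)%N -> (m * l <= n)%N ->
  (pnw n <= 2 ^ (n - l) + (2 ^ l - 1) ^ m * 2 ^ (n - m * l))%N.
Proof.
move=> l0 m0 mln.
have le_ln : (l <= n)%N by apply: leq_trans mln; rewrite leq_pmull.
pose A := [pred w : n.-tuple bool | take l w == nseq l true].
pose B := [pred w : n.-tuple bool | blocks_avoid l m w].
apply: (@leq_trans (#|A| + #|B|)).
  (* Union bound: the sum counts the union plus the intersection, and the latter is dropped. *)
  rewrite -cardUI; apply: leq_trans (leq_addr _ _).
  apply/subset_leq_card/fintype.subsetP => w.
  rewrite !inE => /asboolP/asboolP pw.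
  by apply: prefix_normal_blocks pw; rewrite size_tuple l0.
apply: leq_add.
  by have := card_ones_prefix l (n - l); rewrite /A; move: (subnKC le_ln) => ->.
have := card_blocks_avoid l m (n - m * l).
by rewrite /B; move: (subnKC mln) => ->.
Qed.

(** Factoring out 2^n turns the counts into the probabilities 2^-l and (1 - 2^-l)^m; the second is
    bounded through 1 + t <= exp t at t = - 2^-l. *)
Lemma pnw_le_expR (R : realType) (n l m : nat) :
  (0 < l)%N -> (0 < m)%N -> (m * l <= n)%N ->
  (pnw n)%:R <= 2 ^+ n * ((2 ^+ l)^-1 + expR (- (m%:R / 2 ^+ l))) :> R.
Proof.
move=> l0 m0 mln.
have le_ln : (l <= n)%N by apply: leq_trans mln; rewrite leq_pmull.
have p2 k : (2 : R) ^+ k != 0 by rewrite expf_neq0 // pnatr_eq0.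
have := pnw_le l0 m0 mln; rewrite -(ler_nat R) => /le_trans; apply.
rewrite natrD natrM !natrX natrB ?expn_gt0 // natrX mulrDr.
have Dn : (2 : R) ^+ n = 2 ^+ (n - l) * 2 ^+ l by rewrite -exprD subnK.
have Dm : (2 : R) ^+ n = 2 ^+ (n - m * l) * (2 ^+ l) ^+ m.
  by rewrite -exprM -exprD mulnC subnK // mulnC.
rewrite lerD //; first by rewrite Dn mulfK.
rewrite Dm -mulrA [leLHS]mulrC ler_pM2l ?exprn_gt0 //.
have -> : - (m%:R / 2 ^+ l) = m%:R * - (2 ^+ l)^-1 :> R by rewrite mulrN.
rewrite expRM_natl -exprMn; apply: lerXn2r; rewrite ?nnegrE.
- by rewrite subr_ge0 exprn_ege1 // ler1n.
- by rewrite mulr_ge0 ?expR_ge0 ?exprn_ge0.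
apply: le_trans (ler_wpM2l (exprn_ge0 _ _) (expR_ge1Dx _)) => //.
by rewrite mulrBr mulr1 mulfV.
Qed.

(** Cube of t <= exp t at t = ln x / 3, multiplied by 27 = 3^3. *)
Lemma ln_cube_le (R : realType) (x : R) : 1 <= x -> ln x ^+ 3 <= 27 * x.
Proof.
move=> x1; have x0 : 0 < x by apply: lt_le_trans x1.
have L0 : 0 <= ln x by rewrite ln_ge0.
have -> : 27 * x = (3 * expR (ln x / 3)) ^+ 3.
  rewrite exprMn -expRM_natl mulrC [3%:R * _]mulrC divfK ?pnatr_eq0 //.
  by rewrite lnK // mulrC -natrX.
rewrite lerXn2r ?nnegrE ?mulr_ge0 ?expR_ge0 //.
by have := expR_ge1Dx (ln x / 3); lra.
Qed.

(** In the constant, 4 / ln 2 pays for the words starting with 1^l and 1 for those whose blocks all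
    avoid 1^l. *)
Lemma pnw_bound (R : realType) (n : nat) :
  (1 <= n)%N -> 1 <= ln (n%:R : R) -> 108 <= ln 2 * ln (n%:R : R) ->
  (pnw n)%:R <= (4 / ln 2 + 1) * (2 ^+ n * ln n%:R ^+ 2 / n%:R) :> R.
Proof.
move=> n1; set L := ln _ => L1 L108; set N : R := n%:R in L L1 L108 *.
have N1 : 1 <= N by rewrite ler1n.
have L3 : L ^+ 3 <= 27 * N by exact: ln_cube_le.
have K0 : 0 < ln (2 : R) by rewrite ln_gt0 // ltr1n.
have K1 : ln (2 : R) <= 1.
  by have := @le_ln1Dx R 1; rewrite -natr1 => -> //; rewrite ltrN10.
set K := ln 2 in L108 K0 K1 *.
(* The scale [x] balances the two terms of [pnw_le_expR]: with [2 ^ l <= x] and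
   [l * ln 2 <= L], the exponent satisfies
   [m / 2 ^ l >= N / (2 * l * x) = L ^ 2 / (l * ln 2) >= L]. *)
pose x := N * K / (2 * L ^+ 2).
have L2 : 0 < 2 * L ^+ 2 by rewrite mulr_gt0 // exprn_gt0 //; lra.
have Ex : x * (2 * L ^+ 2) = N * K by rewrite divfK ?gt_eqF.
have x2 : 2 <= x.
  (* The claim is 4 L^2 <= N K, and 108 = 4 * 27 is chosen for it: 108 L^2 <= K L^3 <= 27 N K. *)
  rewrite ler_pdivlMr //.
  have := ler_wpM2l (sqr_ge0 L) L108; have := ler_wpM2l (ltW K0) L3.
  by rewrite !exprS expr0; lra.
have xN : x <= N.
  rewrite ler_pdivrMr //; apply: ler_wpM2l; first by lra.
  have := ler_pM ler01 ler01 L1 L1; rewrite -expr2; lra.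
have xt := truncn_itv (le_trans (ler0n _ 2) x2).
case/andP: xt => tx xt.
have t0 : (0 < Num.truncn x)%N.
  by rewrite truncn_gt0; lra.
(* Rounding the scale to a power of 2 costs a factor below 2: 2^l <= x < 2^(l+1). *)
have [l /andP[lt tl]] : exists l, (2 ^ l <= Num.truncn x < 2 ^ l.+1)%N.
  by exists (trunc_log 2 (Num.truncn x)); exact: trunc_log_bounds.
have lx : 2 ^+ l <= x :> R by apply: le_trans tx; rewrite -natrX ler_nat.
have xl : x < 2 * 2 ^+ l.
  by apply: lt_le_trans xt _; rewrite -exprS -natrX ler_nat.
have l0 : (0 < l)%N.
  by rewrite lt0n; apply/eqP => E; move: xl; rewrite E expr0 mulr1 ltNge x2.
have lL : l%:R * K <= L.
  rewrite mulr_natl -lnXn // ler_ln ?posrE ?exprn_gt0 //; lra.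
have le_ln : (l <= n)%N.
  apply/ltnW/(leq_trans (ltn_expl l (isT : (1 < 2)%N))).
  by rewrite -(ler_nat R) natrX; apply: le_trans xN.
pose m := (n %/ l)%N.
have m0 : (0 < m)%N by rewrite divn_gt0.
(* The remainder of [n] modulo [l] is less than [l], which is at most [m * l]. *)
have nm : N <= 2 * m%:R * l%:R.
  rewrite -!natrM ler_nat mul2n -addnn mulnDl.
  rewrite {1}(divn_eq n l) leq_add2l ltnW //.
  by rewrite (leq_trans (ltn_pmod _ _)) // leq_pmull.
have lR : 1 <= l%:R :> R by rewrite ler1n.
have p0 : 0 < 2 ^+ l :> R by rewrite exprn_gt0.
have Lm : L * 2 ^+ l <= m%:R.
  have H : L * x * 2 * l%:R * K <= N * K.
    have Lx : 0 <= L * x * 2 by nra.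
    by have := ler_wpM2l Lx lL; rewrite -Ex; lra.
  move: H; rewrite ler_pM2r // => H.
  have : L * 2 ^+ l * (2 * l%:R) <= m%:R * (2 * l%:R).
    apply: le_trans (_ : L * x * (2 * l%:R) <= _); last by lra.
    by rewrite ler_pM2r ?ler_pM2l //; lra.
  by rewrite ler_pM2r //; lra.
apply: le_trans (pnw_le_expR R l0 m0 (leq_divM _ _)) _.
rewrite -(mulrA (2 ^+ n)) mulrCA ler_pM2l ?exprn_gt0 //.
have N0 : N != 0 by rewrite gt_eqF //; lra.
have -> : (4 / K + 1) * (L ^+ 2 / N) = 2 / x + L ^+ 2 / N.
  by rewrite /x; field; rewrite !gt_eqF //; lra.
apply: lerD.
  by rewrite ler_pdivlMr ?ler_pdivrMl; lra.
(* As N = exp L, the bound m / 2^l >= L gives exp (- m / 2^l) <= 1 / N, and 1 <= L^2. *)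
apply: (@le_trans _ _ N^-1).
  rewrite -[N]lnK ?posrE; last by lra.
  by rewrite -expRN ler_expR lerN2 ler_pdivlMr.
by rewrite ler_peMl ?invr_ge0; nra.
Qed.

Lemma ln_natr_near (R : realType) (M : R) :
  \forall n \near \oo, M <= ln (n%:R : R).
Proof.
near=> n; have nM : expR M <= n%:R by near: n; exact: nbhs_infty_ger.
rewrite -ler_expR lnK // posrE; exact: lt_le_trans (expR_gt0 _) nM.
Unshelve. all: by end_near. Qed.

(* The chain of asymptotic equalities: pnw(n) = O(g(n)); every O(g(n)) is
   o(2^n); and hence pnw(n) = o(2^n), where g(n) = 2^n (ln n)^2 / n. *)
Theorem theorem2 (R : realType) :
  [/\ (fun n : nat => (pnw n)%:R : R) =O_\oo
        (fun n : nat => 2%:R ^+ n * ln (n%:R : R) ^+ 2 / n%:R : R),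
      (forall h : nat -> R,
        h =O_\oo (fun n : nat => 2%:R ^+ n * ln (n%:R : R) ^+ 2 / n%:R : R) ->
        h =o_\oo (fun n : nat => 2%:R ^+ n : R))
    & (fun n : nat => (pnw n)%:R : R) =o_\oo (fun n : nat => 2%:R ^+ n : R)].
Proof.
set g := fun n : nat => _ / _.
have pO : (fun n : nat => (pnw n)%:R : R) =O_\oo g.
  apply/eqO_exP.
  have K0 : 0 < ln (2 : R) by rewrite ln_gt0 // ltr1n.
  exists (4 / ln 2 + 1); first by rewrite ltr_wpDl // divr_ge0 // ltW.
  near=> n.
  have n1 : (1 <= n)%N by near: n; exact: nbhs_infty_ge.
  rewrite ger0_norm // (le_trans (@pnw_bound R n n1 _ _)) //.
  - by near: n; exact: ln_natr_near.
  - rewrite mulrC -ler_pdivrMr //; near: n; exact: ln_natr_near.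
  - by rewrite ler_wpM2l ?ler_norm // ltW // ltr_wpDl // divr_ge0 // ltW.
have Oo (h : nat -> R) : h =O_\oo g -> h =o_\oo (fun n : nat => 2%:R ^+ n : R).
  move=> /eqO_exP[C C0 hC]; apply/eqoP => e e0; near=> n.
  have hn : `|h n| <= C * `|g n| by near: n.
  apply: le_trans hn _.
  have n1 : (1 <= n)%N by near: n; exact: nbhs_infty_ge.
  have N1 : 1 <= n%:R :> R by rewrite ler1n.
  have L1 : 1 <= ln (n%:R : R) by near: n; exact: ln_natr_near.
  (* By the cube bound, C (ln n)^2 / n <= 27 C / ln n, which is at most [e] from this threshold
     on. *)
  have LC : 27 * C / e <= ln (n%:R : R) by near: n; exact: ln_natr_near.
  have L3 := ln_cube_le N1.
  have p0 : 0 < 2 ^+ n :> R by rewrite exprn_gt0.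
  have L0 : 0 <= ln (n%:R : R) by lra.
  rewrite /g !ger0_norm ?divr_ge0 ?mulr_ge0 ?sqr_ge0 ?exprn_ge0 //.
  rewrite -(mulrA (2 ^+ n)) mulrCA [leRHS]mulrC ler_pM2l // mulrA.
  rewrite ler_pdivrMr; last by lra.
  rewrite ler_pdivrMr // in LC.
  set L := ln _ in L1 LC L3 *.
  have : 27 * C * L ^+ 2 <= L * e * L ^+ 2 by rewrite ler_wpM2r ?sqr_ge0.
  have : L ^+ 3 * e <= 27 * n%:R * e by rewrite ler_pM2r.
  by rewrite !exprS expr0; lra.
by split=> //; exact: Oo.
Unshelve. all: by end_near. Qed.
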